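(* Let $T$ and $T'$ be finite trees, each having a single centroid, and let $f:E(T)\to E(T')$ be a bijection such that $\theta_{T'}(f(e))=\theta_T(e)$ for every edge $e\in E(T)$ and $\theta_{T'}(\{f(e),f(e')\})=\theta_T(\{e,e'\})$ for all distinct edges $e,e'\in E(T)$. Then $T$ and $T'$ are isomorphic. In other words, a tree with a single centroid is determined (up to isomorphism) by its edge set together with the values $\theta_T(e_i)$ for all edges $e_i$ and $\theta_T(\{e_i,e_k\})$ for all distinct edges $e_i,e_k$.
   Context: For a finite tree $T$ and a set $S\subseteq E(T)$, $\theta_T(S)$ is the partition of $\#V(T)$ whose parts are the numbers of vertices of the connected components of the graph $(V(T),E(T)\setminus S)$; for a single edge $e$ write $\theta_T(e)=\theta_T(\{e\})$. The weight of a vertex $v$ of $T$ is the maximal number of edges in any subtree of $T$ containing $v$ as a leaf; the centroid of $T$ is the set of vertices of minimum weight, and $T$ has a single centroid if this set has exactly one element. *)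

(* Defs.v *)
From mathcomp Require Import all_boot.

Set Implicit Arguments.
Unset Strict Implicit.
Unset Printing Implicit Defensive.

Record sgraph := SGraph {
  vertex :> finType;
  adj : rel vertex;
  adj_sym : symmetric adj;
  adj_irr : irreflexive adj }.

Definition edge_set (G : sgraph) : {set {set G}} :=
  [set [set x; y] | x in G, y in G & adj x y].

Definition edge (G : sgraph) := {A : {set G} | A \in edge_set G}.

Definition edge_between (G : sgraph) (S : {set edge G}) (x y : G) : bool :=
  [exists e in S, val e == [set x; y]].

Lemma edge_between_sym (G : sgraph) (S : {set edge G}) :
  symmetric (edge_between S).
Proof. by move=> x y; rewrite /edge_between setUC. Qed.

Definition connected (G : sgraph) : bool :=
  (0 < #|G|) && [forall x : G, forall y : G, connect (@adj G) x y].

(* A duplicate-free closed walk of length at least 3 is a cycle of the graph;  *)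
(* being duplicate-free, it has at most #|G| vertices, so bounding n loses     *)
(* nothing.                                                                    *)
Definition acyclic (G : sgraph) : bool :=
  [forall n : 'I_#|G|.+1, forall c : n.-tuple G,
     ucycleb (@adj G) c ==> (n < 3)].

Definition is_tree (G : sgraph) : bool := connected G && acyclic G.

Definition isomorphic (G G' : sgraph) : Prop :=
  exists2 h : G -> G', bijective h & forall x y, adj (h x) (h y) = adj x y.

Section DelEdges.
Variables (G : sgraph) (S : {set edge G}).

Definition del_adj : rel G := [rel x y | adj x y && ~~ edge_between S x y].

Lemma del_adj_sym : symmetric del_adj.
Proof. by move=> x y; rewrite /del_adj /= adj_sym edge_between_sym. Qed.

Lemma del_adj_irr : irreflexive del_adj.
Proof. by move=> x; rewrite /del_adj /= adj_irr. Qed.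

Definition del_edges : sgraph := SGraph del_adj_sym del_adj_irr.

End DelEdges.

Definition components (G : sgraph) : {set {set G}} :=
  equivalence_partition (connect (@adj G)) [set: G].

(* An integer partition is represented by the list of its parts in             *)
(* nonincreasing order.                                                        *)
Definition theta (G : sgraph) (S : {set edge G}) : seq nat :=
  sort geq [seq #|C| | C : {set del_edges S} in components (del_edges S)].

Section Subgraph.
Variables (G : sgraph) (W : {set G}) (F : {set edge G}).

Definition sub_adj : rel {x : G | x \in W} :=
  [rel x y | adj (val x) (val y) && edge_between F (val x) (val y)].

Lemma sub_adj_sym : symmetric sub_adj.
Proof. by move=> x y; rewrite /sub_adj /= adj_sym edge_between_sym. Qed.

Lemma sub_adj_irr : irreflexive sub_adj.
Proof. by move=> x; rewrite /sub_adj /= adj_irr. Qed.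

Definition subgraph : sgraph := SGraph sub_adj_sym sub_adj_irr.

Definition subtree : bool :=
  [forall e in F, val e \subset W] && is_tree subgraph.

Definition leaf (v : G) : bool :=
  (v \in W) && (#|[set e in F | v \in val e]| == 1).

End Subgraph.

(* In a one-vertex tree no subtree has v as a leaf, and the weight is 0.       *)
Definition weight (G : sgraph) (v : G) : nat :=
  \max_(H : {set G} * {set edge G} | subtree H.1 H.2 && leaf H.1 H.2 v) #|H.2|.

Definition centroid (G : sgraph) : {set G} :=
  [set v | [forall u : G, weight v <= weight u]].

Definition single_centroid (G : sgraph) : Prop := #|centroid G| = 1.

(* Main.v *)
Require Import Defs.
From mathcomp Require Import all_boot.

Set Implicit Arguments.
Unset Strict Implicit.
Unset Printing Implicit Defensive.

(* Root a tree with [n] vertices at its only centroid vertex. Then the part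
   [D(e)] below an edge [e] has fewer than [n/2] vertices, for otherwise the
   root's child above [e] would also be a centroid vertex. Hence [n - #|D(e)|]
   is the largest part of [theta [set e]], and for [e != e'] it is a part of
   [theta [set e'; e]] exactly when [D(e')] is contained in [D(e)]. So [f]
   preserves the inclusion order of the sets [D(e)], that is, the ancestor order
   on the lower endpoints of the edges; the tree is the covering graph of this
   order with the root added on top. *)

(** * Rooting a tree at a vertex *)

Record rooting (G : sgraph) (r : G) (par : G -> G) : Prop := Rooting {
  par_root : par r = r;
  par_connect_root : forall v, fconnect par v r;
  adj_par : forall x y, adj x y = (x != y) && ((par x == y) || (par y == x)) }.

Section Rooting.
Variables (G : sgraph) (r : G).

Lemma acyclicP : acyclic G ->
  forall c : seq G, ucycle (@adj G) c -> size c < 3.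
Proof.
move=> /forallP acG c cyc_c.
have c_bound : size c < #|G|.+1.
  by rewrite ltnS -(card_uniqP (ucycle_uniq cyc_c)) max_card.
by move: (acG (Ordinal c_bound)) => /forallP /(_ (in_tuple c)) /implyP; apply.
Qed.

Definition adj_avoid (v : G) : rel G :=
  [rel x y | [&& adj x y, x != v & y != v]].

(** In a tree this singles out the neighbour of [v] on the way to [r]. The root has no parent, since
    [adj_avoid r] isolates it. *)
Definition is_parent (v x : G) : bool := adj x v && connect (adj_avoid v) r x.

Lemma adj_avoid_sym v : connect_sym (adj_avoid v).
Proof.
apply: sym_connect_sym => x y; rewrite /adj_avoid /= adj_sym.
by rewrite [(x != v) && _]andbC.
Qed.

Lemma path_avoid v x p : v \notin x :: p ->
  path (@adj G) x p -> path (adj_avoid v) x p.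
Proof.
elim: p x => [//|y p IHp] x; rewrite inE negb_or => /andP[xv vp] /=.
case/andP=> xy yp; rewrite /adj_avoid /= xy (eq_sym x) xv IHp // andbT.
by move: vp; rewrite inE negb_or eq_sym => /andP[].
Qed.

Lemma avoid_path v x p : path (adj_avoid v) x p ->
  path (@adj G) x p /\ (v \notin p).
Proof.
elim: p x => [//|y p IHp] x /= /andP[/and3P[xy _ yv] /IHp[yp vp]].
by rewrite xy yp inE negb_or vp eq_sym yv.
Qed.

Hypothesis acG : acyclic G.

(** Two distinct parents would be joined by a path avoiding [v], and [v] would close that path into
    a cycle. *)
Lemma is_parent_uniq v x y : is_parent v x -> is_parent v y -> x = y.
Proof.
move=> /andP[xv rx] /andP[yv ry]; apply/eqP/negP=> xNy.
have /connectP[p0 p0P yE] : connect (adj_avoid v) x y.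
  by apply: connect_trans ry; rewrite adj_avoid_sym.
move: xNy yv; rewrite yE; case/shortenP: p0P {yE} => p pP Up _ xNy yv.
have [adj_p vNp] := avoid_path pP.
have vNx : v != x by apply: contraTneq xv => <-; rewrite adj_irr.
have: ucycle (@adj G) [:: v, x & p].
  rewrite /ucycle [uniq _]/= inE negb_or vNx vNp -[_ && uniq p]/(uniq (x :: p)).
  by rewrite Up /= adj_sym xv rcons_path adj_p yv.
(* As [x != y], the path [p] is nonempty and the cycle has at least three vertices. *)
move/(acyclicP acG); case: p xNy {pP Up yv adj_p vNp} => //=.
Qed.

Lemma is_parent_path p v : path (@adj G) r (rcons p v) ->
  uniq (r :: rcons p v) -> is_parent v (last r p).
Proof.
rewrite rcons_path -rcons_cons rcons_uniq /is_parent => /andP[pP ->] /andP[vNp _].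
by apply/connectP; exists p => //; apply: path_avoid.
Qed.

(** Take a duplicate-free path from [r] to [x]. If it misses [y], it makes [x] the parent of [y];
    otherwise its initial part up to [y] avoids [x] and makes [y] the parent of [x]. *)
Lemma adj_is_parent x y : connect (@adj G) r x -> adj x y ->
  is_parent x y || is_parent y x.
Proof.
move=> /connectP[p0 p0P ->]; case/shortenP: p0P => p pP Up _ {p0} xy.
case yp: (y \in r :: p); last first.
  apply/orP; right; rewrite /is_parent xy; apply/connectP; exists p => //.
  by apply: path_avoid; rewrite ?yp.
apply/orP; left; rewrite /is_parent adj_sym xy /=.
have yNl : y != last r p by apply: contraTneq xy => <-; rewrite adj_irr.
case/splitPl: yp pP Up yNl => p1 p2 p1y; rewrite cat_path last_cat p1y.
case/lastP: p2 => [|p2 z]; first by rewrite eqxx.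
rewrite last_rcons -cat_cons cat_uniq has_rcons => /andP[p1P _].
case/and3P=> _ /norP[zNp1 _] _ _; apply/connectP; exists p1 => //.
by apply: path_avoid.
Qed.

Lemma exists_rooting : connected G -> exists par, rooting r par.
Proof.
case/andP=> _ /forallP conG.
(* The default [v] serves the root, giving [par r = r]. *)
pose par v := odflt v [pick x | is_parent v x].
have parE v x : is_parent v x -> par v = x.
  move=> vx; rewrite /par; case: pickP => [y vy|/(_ x)]; last by rewrite vx.
  exact: is_parent_uniq vy vx.
have par_r : par r = r.
  rewrite /par; case: pickP => //= x /andP[xr /connectP[[|y p] /=]].
    by move=> _ xE; rewrite xE adj_irr in xr.
  by rewrite /adj_avoid /= eqxx andbF.
have conr v : connect (@adj G) r v by move/forallP: (conG r); apply.
have par_path p : path (@adj G) r p -> uniq (r :: p) -> fconnect par (last r p) r.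
  elim/last_ind: p => [|p v IHp] pP Up; first exact: connect0.
  rewrite last_rcons fconnect_eqVf (parE _ _ (is_parent_path pP Up)) orbC.
  move: pP Up; rewrite rcons_path -rcons_cons rcons_uniq => /andP[pP _] /andP[_ Up].
  by rewrite IHp.
exists par; split=> // [v | x y].
  by have /connectP[p0 p0P ->] := conr v; case/shortenP: p0P => p pP Up _; apply: par_path.
apply/idP/idP.
  move=> xy; case/orP: (adj_is_parent (conr x) xy) => /parE parxy.
    by rewrite parxy eqxx andbT; apply: contraTneq xy => ->; rewrite adj_irr.
  by rewrite parxy eqxx orbT andbT; apply: contraTneq xy => ->; rewrite adj_irr.
have par_adj u : par u != u -> adj u (par u).
  rewrite /par; case: pickP => [z /andP[zu _] _ | _] /=; first by rewrite adj_sym.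
  by rewrite eqxx.
case/andP=> xNy /orP[]/eqP pE; first by rewrite -pE par_adj // pE eq_sym.
by rewrite -pE adj_sym par_adj // pE.
Qed.

End Rooting.

(** * Descendants and the ancestor order *)

Definition desc (G : sgraph) (par : G -> G) (u : G) : {set G} :=
  [set z | fconnect par z u].

(** The test [v != r] excludes the root, which is its own image under [par] and would otherwise
    qualify in every edge at [r]. *)
Definition child_end (G : sgraph) (par : G -> G) (r : G) (e : edge G) : G :=
  odflt r [pick v in val e | (v != r) && (par v \in val e)].

(** The covering relation of the ancestor order, with [w] the least strict ancestor of [v]. It is
    phrased by [fconnect] alone, so that a bijection preserving the order preserves it. *)
Definition covers (G : sgraph) (par : G -> G) (w v : G) : bool :=
  [&& v != w, fconnect par v w &
      [forall u, (v != u) && fconnect par v u ==> fconnect par w u]].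

Section Rooted.
Variables (G : sgraph) (r : G) (par : G -> G).
Hypothesis rootG : rooting r par.

Local Notation desc := (desc par).
Local Notation ch := (child_end par r).

Lemma iter_par_root k : iter k par r = r.
Proof. by elim: k => //= k ->; exact: par_root rootG. Qed.

Lemma fconnect_root v : fconnect par r v = (v == r).
Proof.
apply/idP/eqP=> [/iter_findex <-|->]; [exact: iter_par_root | exact: connect0].
Qed.

Lemma par_ind (P : G -> Prop) :
  P r -> (forall v, v != r -> P (par v) -> P v) -> forall v, P v.
Proof.
move=> Pr Ppar v; have /iter_findex := par_connect_root rootG v.
move: (findex _ _ _) => k; elim: k v => [v /= ->//|k IHk] v.
have [->//|vr] := eqVneq v r.
by rewrite iterSr => /IHk; apply: Ppar.
Qed.

(** If [par v] leads back to [v], then [v] is periodic under [par]; but its iterates end at the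
    fixed point [r], so [v] is [r]. *)
Lemma fconnect_par_self v : fconnect par (par v) v = (v == r).
Proof.
apply/idP/eqP=> [|->]; last by rewrite (par_root rootG) connect0.
move=> /iter_findex; rewrite -iterSr; move: (findex _ _ _) => k kE.
have loop m : iter (m * k.+1) par v = v.
  by elim: m => // m IHm; rewrite mulSn iterD IHm kE.
have /iter_findex := par_connect_root rootG v; move: (findex _ _ _) => l lE.
(* Going [l] times around the loop takes at least [l] steps, and [l] steps already reach [r]. *)
rewrite -[LHS](loop l) -[l * _](@subnK l) ?leq_pmulr // iterD lE.
exact: iter_par_root.
Qed.

Lemma par_neq v : v != r -> par v != v.
Proof.
by apply: contraNneq => parv; rewrite -fconnect_par_self parv connect0.
Qed.

Lemma fconnect_anti v w : fconnect par v w -> fconnect par w v -> v = w.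
Proof.
move=> vw wv; apply/eqP; move: (vw); rewrite fconnect_eqVf => /orP[//|pvw].
have := connect_trans pvw wv; rewrite fconnect_par_self => /eqP vr.
by move: vw; rewrite vr fconnect_root eq_sym.
Qed.

Lemma adj_par_edge v : v != r -> adj v (par v).
Proof. by move=> vr; rewrite (adj_par rootG) eq_sym par_neq ?eqxx. Qed.

Lemma coversE w v : covers par w v = (v != r) && (par v == w).
Proof.
apply/and3P/andP=> [[vw vcw /forallP minw] | [vr /eqP <-]]; last first.
  split; first by rewrite eq_sym par_neq.
    exact: fconnect1.
  apply/forallP=> u; apply/implyP=> /andP[/negPf vu].
  by rewrite fconnect_eqVf vu.
have vr : v != r.
  by apply: contraNneq vw => vr; move: vcw; rewrite vr fconnect_root eq_sym.
split=> //; apply/eqP/fconnect_anti.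
  by move: vcw; rewrite fconnect_eqVf (negPf vw).
by have /implyP := minw (par v); apply; rewrite eq_sym par_neq // fconnect1.
Qed.

Lemma adjE_covers x y : adj x y = covers par x y || covers par y x.
Proof.
rewrite (adj_par rootG) !coversE.
apply/andP/orP=> [[xy] /orP[]/eqP pE | [] /andP[nr /eqP <-]].
- right; rewrite pE eqxx andbT; apply: contraNneq xy => xr.
  by rewrite -pE xr (par_root rootG).
- left; rewrite pE eqxx andbT; apply: contraNneq xy => xr.
  by rewrite -pE xr (par_root rootG).
- by rewrite eqxx orbT par_neq.
- by rewrite eqxx eq_sym par_neq.
Qed.

Lemma mem_desc z u : (z \in desc u) = fconnect par z u.
Proof. by rewrite inE. Qed.

Lemma desc_self u : u \in desc u.
Proof. by rewrite inE connect0. Qed.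

Lemma desc_root u : u != r -> r \notin desc u.
Proof. by rewrite inE fconnect_root. Qed.

Lemma desc_par u z : z != u -> (par z \in desc u) = (z \in desc u).
Proof. by rewrite !inE [in RHS]fconnect_eqVf => /negPf ->. Qed.

Lemma par_notin_desc u : u != r -> par u \notin desc u.
Proof. by rewrite inE fconnect_par_self. Qed.

Lemma desc_sub u w : (desc u \subset desc w) = fconnect par u w.
Proof.
apply/subsetP/idP=> [/(_ u (desc_self u))|uw z]; first by rewrite inE.
by rewrite !inE => /connect_trans; apply.
Qed.

Lemma card_descC u : #|~: desc u| = #|G| - #|desc u|.
Proof. by rewrite cardsCs setCK. Qed.

(** * Edges and their lower endpoints *)

Lemma edgeP (e : edge G) : exists2 v, v != r & val e = [set v; par v].
Proof.
case: e => A /= /imset2P[x y _]; rewrite inE adjE_covers !coversE => xy ->.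
case/orP: xy => /andP[nr /eqP <-]; last by exists x.
by exists y; rewrite // setUC.
Qed.

Lemma parent_edge_inj v w : v != r -> w != r ->
  [set v; par v] = [set w; par w] -> v = w.
Proof.
move=> vr wr E; have: v \in [set w; par w] by rewrite -E set21.
have: w \in [set v; par v] by rewrite E set21.
rewrite !inE => /orP[/eqP->//|/eqP wpv] /orP[/eqP->//|/eqP vpw].
apply: fconnect_anti; last by rewrite vpw fconnect1.
by rewrite wpv fconnect1.
Qed.

Lemma child_endP e : ch e != r /\ val e = [set ch e; par (ch e)].
Proof.
have [v vr eE] := edgeP e; suff -> : ch e = v by [].
rewrite /child_end; case: pickP => [w|/(_ v)] /=; last first.
  by rewrite eE !inE !eqxx vr orbT.
(* Had [pick] chosen [par v], the parent of [par v] would be [v] or [par v]; either leads back to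
   [par v], which would then be the root. *)
rewrite eE !inE => /and3P[/orP[/eqP//|/eqP ->] pvr].
rewrite -fconnect_par_self in pvr.
by case/orP=> /eqP pE; rewrite pE ?fconnect1 ?connect0 in pvr.
Qed.

Lemma child_end_neq_root e : ch e != r.
Proof. by case: (child_endP e). Qed.

Lemma child_end_val e : val e = [set ch e; par (ch e)].
Proof. by case: (child_endP e). Qed.

Lemma child_end_inj : injective ch.
Proof. by move=> e e' E; apply: val_inj; rewrite !child_end_val E. Qed.

Lemma child_end_onto v : v != r -> exists e, ch e = v.
Proof.
move=> vr; have vE : [set v; par v] \in edge_set G.
  by apply: imset2_f; rewrite // inE adj_par_edge.
exists (Sub [set v; par v] vE); apply: parent_edge_inj => //.
  exact: child_end_neq_root.
by rewrite -child_end_val.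
Qed.

Lemma edge_between_par (S : {set edge G}) v :
  v != r -> edge_between S v (par v) = (v \in ch @: S).
Proof.
move=> vr; apply/existsP/imsetP => [[e /andP[eS /eqP eE]] | [e eS ->]].
  exists e => //; apply: parent_edge_inj => //; first exact: child_end_neq_root.
  by rewrite -child_end_val.
by exists e; rewrite eS child_end_val eqxx.
Qed.

Lemma card_child_end (A : {set G}) :
  r \notin A -> #|[set e | ch e \in A]| = #|A|.
Proof.
move=> rA; rewrite -(card_imset _ child_end_inj); apply: eq_card => v.
apply/imsetP/idP=> [[e]|vA]; first by rewrite inE => eA ->.
have vr : v != r by apply: contraNneq rA => <-.
by have [e eE] := child_end_onto vr; exists e; rewrite ?inE ?eE.
Qed.

Lemma card_vertex : #|G| = #|{: edge G}|.+1.
Proof.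
have := @card_child_end (~: [set r]); rewrite !inE eqxx => /(_ isT).
rewrite cardsC1; have -> : [set e | ch e \in ~: [set r]] = setT.
  by apply/setP=> e; rewrite !inE child_end_neq_root.
rewrite cardsT => ->; rewrite prednK //; apply/card_gt0P; by exists r.
Qed.

(** * Component sizes after deleting edges *)

(** The only edge of the tree leaving the branch [desc (ch e)] is [e] itself, and it is deleted. *)
Lemma del_adj_closed (S : {set edge G}) e :
  e \in S -> closed (del_adj S) (desc (ch e)).
Proof.
move=> eS.
have down v : v != r -> ~~ edge_between S v (par v) ->
    (v \in desc (ch e)) = (par v \in desc (ch e)).
  move=> vr; rewrite edge_between_par // => vS; rewrite desc_par //.
  by apply: contraNneq vS => ->; apply: imset_f.
move=> x y /= /andP[]; rewrite adjE_covers !coversE.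
by case/orP=> /andP[nr /eqP <-]; [rewrite edge_between_sym|] => /down ->.
Qed.

(** A vertex below a deleted edge is cut off by [del_adj_closed]; any other climbs to [r] along
    [par] without meeting a deleted edge. *)
Lemma del_connect_root (S : {set edge G}) z :
  connect (del_adj S) r z = [forall e in S, z \notin desc (ch e)].
Proof.
apply/idP/forall_inP=> [rz e eS | ].
  rewrite -(closed_connect (del_adj_closed eS) rz).
  exact/desc_root/child_end_neq_root.
elim/par_ind: z => [_|v vr IHv vS]; first exact: connect0.
have vNS : v \notin ch @: S.
  by apply/imsetP=> -[e /vS eS vE]; rewrite vE desc_self in eS.
have vpv : del_adj S (par v) v.
  by rewrite del_adj_sym /del_adj /= adj_par_edge // edge_between_par.
apply: connect_trans (connect1 vpv); apply: IHv => e eS.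
rewrite desc_par ?vS //; apply: contraNneq vNS => ->; exact: imset_f.
Qed.

Lemma mem_theta (S : {set edge G}) k :
  reflect (exists x, k = #|[set z | connect (del_adj S) x z]|) (k \in theta S).
Proof.
rewrite /theta mem_sort; apply: (iffP imageP) => [[C /imsetP[x _ ->] ->] | [x ->]].
  by exists x; apply: eq_card => z; rewrite !inE.
exists [set z | connect (del_adj S) x z] => //.
by apply/imsetP; exists x => //; apply/setP=> z; rewrite !inE.
Qed.

Lemma component_desc (S : {set edge G}) e x : e \in S ->
  [set z | connect (del_adj S) x z] \subset
     (if x \in desc (ch e) then desc (ch e) else ~: desc (ch e)).
Proof.
move=> eS; apply/subsetP=> z; rewrite inE => /(closed_connect (del_adj_closed eS)).
by move=> xz; case: ifP => xe; rewrite ?in_setC -xz xe.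
Qed.

Hypothesis small_desc : forall v, v != r -> (#|desc v|).*2 < #|G|.

(** Two branches, each with fewer than half of the vertices, cannot fill the tree. Hence a component
    as large as the complement of a branch fits in no branch. *)
Lemma card_desc_lt v w : v != r -> w != r -> #|desc v| < #|G| - #|desc w|.
Proof.
move=> /small_desc vs /small_desc ws; rewrite ltn_subRL -ltn_double doubleD.
by rewrite -[(#|G|).*2]addnn -addSn leq_add // ltnW.
Qed.

Lemma theta1_mem e : #|G| - #|desc (ch e)| \in theta [set e].
Proof.
apply/mem_theta; exists r; rewrite -card_descC; apply: eq_card => z.
rewrite in_setC !inE del_connect_root; apply/idP/forall_inP=> [ze e' | ].
  by rewrite inE => /eqP->; rewrite mem_desc.
by move/(_ e (set11 e)); rewrite mem_desc.
Qed.

Lemma theta1_max e k : k \in theta [set e] -> k <= #|G| - #|desc (ch e)|.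
Proof.
case/mem_theta=> x ->; apply: leq_trans (subset_leq_card (component_desc x (set11 e))) _.
case: ifP => _; last by rewrite card_descC.
by apply: ltnW; apply: card_desc_lt; apply: child_end_neq_root.
Qed.

(* The root component has [#|G| - #|desc (ch e')|] vertices exactly when
   deleting [e] on top of [e'] does not shrink it, and no other component is
   that large, since the others have fewer than half of the vertices. *)
Lemma theta2_mem e e' :
  (#|G| - #|desc (ch e')| \in theta [set e; e']) = fconnect par (ch e) (ch e').
Proof.
apply/mem_theta/idP => [[x cE] | ee']; last first.
  exists r; rewrite -card_descC; apply: eq_card => z.
  rewrite in_setC !inE del_connect_root.
  apply/idP/forall_inP=> [ze d | /(_ e' (set22 e e'))]; last by rewrite mem_desc.
  rewrite !inE => /orP[]/eqP-> //.
  by apply: contra ze => /connect_trans; apply.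
have := component_desc x (set21 e e'); have := component_desc x (set22 e e').
have lt_e d : #|desc (ch d)| < #|G| - #|desc (ch e')|.
  by apply: card_desc_lt; apply: child_end_neq_root.
set C := [set z | _] in cE *; case: ifP => xe' Ce'; case: ifP => xe Ce.
(* In the first three cases the component lies in a branch and is too small. In the last it avoids
   both branches, so by its size it is the whole complement of [desc (ch e')]. *)
- by have := subset_leq_card Ce'; rewrite -cE leqNgt lt_e.
- by have := subset_leq_card Ce'; rewrite -cE leqNgt lt_e.
- by have := subset_leq_card Ce; rewrite -cE leqNgt lt_e.
rewrite -desc_sub -setCS; suff <- : C = ~: desc (ch e') by exact: Ce.
by apply/eqP; rewrite eqEcard Ce' -cE card_descC leqnn.
Qed.

End Rooted.

(** * Subtrees, weights and the centroid *)

Lemma acyclic_subgraph (G : sgraph) (W : {set G}) (F : {set edge G}) :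
  acyclic G -> acyclic (subgraph W F).
Proof.
move=> acG; apply/forallP=> n; apply/forallP=> c; apply/implyP=> /andP[cyc_c Uc].
rewrite -(size_tuple c) -(size_map val c); apply: (acyclicP acG).
rewrite /ucycle map_inj_uniq ?Uc ?andbT; last exact: val_inj.
case: (tval c) cyc_c => //= x s; rewrite -map_rcons path_map.
by apply: sub_path => y z /andP[].
Qed.

Section Weight.
Variables (G : sgraph) (r : G) (par : G -> G).
Hypothesis rootG : rooting r par.

Local Notation desc := (desc par).
Local Notation ch := (child_end par r).

(** No edge of [F] crosses the boundary of [A], so the connected subtree lies wholly inside or
    wholly outside [A]. *)
Lemma subtree_closed (W : {set G}) (F : {set edge G}) (A : {set G}) :
    subtree W F ->
    {in F, forall e, (ch e \in A) = (par (ch e) \in A)} ->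
  {in W &, forall x y, (x \in A) = (y \in A)}.
Proof.
case/andP=> _ /andP[/andP[_ /forallP conW] _] clA x y xW yW.
have clo : closed (@adj (subgraph W F)) [pred z | val z \in A].
  move=> a b /andP[_ /existsP[e /andP[eF /eqP]]]; rewrite (child_end_val rootG).
  move: (clA e eF) => eA abE; rewrite !inE.
  have : val a \in [set ch e; par (ch e)] by rewrite abE set21.
  have : val b \in [set ch e; par (ch e)] by rewrite abE set22.
  by rewrite !inE => /orP[]/eqP-> /orP[]/eqP->.
have := conW (Sub x xW) => /forallP/(_ (Sub y yW))/(closed_connect clo).
by rewrite !inE.
Qed.

(** The subtree leaves [x] by a single edge. If that edge goes up, nothing strictly below [x] is
    reached; if it goes down, the subtree stays in [desc x]. Edges are counted by their lower
    endpoints. *)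
Lemma card_subtree_le (W : {set G}) (F : {set edge G}) x :
    x != r -> subtree W F -> leaf W F x ->
  #|F| <= maxn #|desc x| (#|G| - #|desc x|).
Proof.
move=> xr WF /andP[xW /cards1P[e0 e0E]].
have F_W e : e \in F -> ch e \in W.
  case/andP: WF => /forall_inP FW _ /FW/subsetP; apply.
  by rewrite (child_end_val rootG) set21.
have [ex exE] := child_end_onto rootG xr; rewrite leq_max.
have F_x e : e \in F -> x \in val e -> e = e0.
  by move=> eF xe; apply/set1P; rewrite -e0E inE eF.
case: (boolP (ex \in F)) => exF; apply/orP; [right | left].
  pose A := desc x :\ x.
  have clA : {in F, forall e, (ch e \in A) = (par (ch e) \in A)}.
    move=> e eF; rewrite !in_setD1; have [->|ex'] := eqVneq (ch e) x.
      by rewrite (negPf (par_notin_desc rootG xr)) andbF.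
    rewrite desc_par //; case: eqP => // pex; case/eqP: ex'.
    rewrite -exE (F_x ex) ?(child_end_val rootG) ?exE ?set21 //.
    by rewrite -(F_x e) // (child_end_val rootG) pex set22.
  have F_A e : e \in F -> ch e \notin A.
    by move=> eF; rewrite (subtree_closed WF clA (F_W e eF) xW) !inE eqxx.
  (* [B] holds the possible lower endpoints: [x] and the vertices outside its branch except [r].
     Trading [r] for [x] keeps the size of the complement. *)
  pose B := x |: (~: desc x :\ r).
  have <- : #|B| = #|G| - #|desc x|.
    rewrite -(card_descC par) cardsU1 (cardsD1 r (~: desc x)) !in_setD1 !in_setC.
    by rewrite (desc_root rootG xr) (desc_self par) andbF.
  rewrite -(card_child_end rootG (A := B)); last by rewrite !inE eqxx eq_sym (negPf xr).
  apply/subset_leq_card/subsetP=> e eF; rewrite inE in_setU1 in_setD1 in_setC.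
  rewrite (child_end_neq_root rootG); move: (F_A e eF); rewrite in_setD1.
  by case: (ch e == x).
have clD : {in F, forall e, (ch e \in desc x) = (par (ch e) \in desc x)}.
  move=> e eF; rewrite desc_par //; apply: contraNneq exF => cex.
  by rewrite -(child_end_inj rootG (etrans cex (esym exE))).
rewrite -(card_child_end rootG (desc_root rootG xr)).
apply/subset_leq_card/subsetP=> e eF; rewrite inE.
by rewrite (subtree_closed WF clD (F_W e eF) xW) desc_self.
Qed.

(* The branch hanging from the root at [x], together with the root, is a
   subtree with the root as a leaf. *)
Lemma weight_root_ge x : acyclic G -> x != r -> par x = r ->
  #|desc x| <= weight r.
Proof.
move=> acG xr xE; have rNx := desc_root rootG xr.
pose W := r |: desc x; pose F := [set e | ch e \in desc x].
have [ex exE] := child_end_onto rootG xr.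
have parW v : v \in desc x -> par v \in W.
  move=> vx; rewrite in_setU1; have [->|vNx] := eqVneq v x; first by rewrite xE eqxx.
  by rewrite desc_par // vx orbT.
have FW e : e \in F -> val e \subset W.
  rewrite inE (child_end_val rootG) subUset !sub1set => ex'.
  by rewrite parW // in_setU1 ex' orbT.
have rW : r \in W by rewrite setU11.
have con v (vW : v \in W) :
    connect (@adj (subgraph W F)) (Sub v vW) (Sub r rW).
  elim/(par_ind rootG): v vW => [rW'|v vr IHv vW].
    by rewrite (bool_irrelevance rW' rW) connect0.
  have vx : v \in desc x by move: vW; rewrite in_setU1 (negPf vr).
  apply: connect_trans (IHv (parW v vx)); apply: connect1.
  rewrite /= /sub_adj /= (adj_par_edge rootG) //= (edge_between_par rootG) //.
  have [e eE] := child_end_onto rootG vr; rewrite -eE; apply: imset_f.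
  by rewrite inE eE.
have treeWF : subtree W F.
  apply/andP; split; first exact/forall_inP.
  apply/andP; split; last exact: acyclic_subgraph.
  apply/andP; split; first by apply/card_gt0P; exists (Sub r rW).
  apply/forallP=> -[v vW]; apply/forallP=> -[w wW].
  apply: connect_trans (con v vW) _.
  by rewrite (sym_connect_sym (@adj_sym (subgraph W F))); apply: con.
have leafr : leaf W F r.
  (* The edge above [x] is the only edge of [F] at [r]: a vertex of [desc x] other than [x] has its
     parent in [desc x], which does not contain [r]. *)
  rewrite /leaf rW; apply/cards1P; exists ex; apply/setP=> e.
  rewrite in_set1 !inE (child_end_val rootG); apply/andP/eqP=> [[ex' re]|->].
    apply: (child_end_inj rootG); rewrite exE; apply/eqP; apply: contraNT rNx => neq.
    move: re; rewrite !inE eq_sym (negPf (child_end_neq_root rootG e)) /= => /eqP rE.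
    by rewrite [in X in fconnect _ X]rE -(mem_desc par) desc_par // mem_desc.
  by rewrite exE connect0 xE set22.
rewrite -(card_child_end rootG rNx) -/F.
exact: (leq_bigmax_cond (F := fun H : {set G} * {set edge G} => #|H.2|)
          (W, F) (introT andP (conj treeWF leafr))).
Qed.

(* A root child whose branch held half of the vertices would have weight at
   most that of the root, so it would be a second centroid vertex. *)
Lemma single_centroid_small_desc : acyclic G -> centroid G = [set r] ->
  forall v, v != r -> (#|desc v|).*2 < #|G|.
Proof.
move=> acG cG v vr.
(* It suffices to bound the branch of the root child [x] above [v], as it contains [desc v]. *)
have [x [xr xE vx]] : exists x, [/\ x != r, par x = r & fconnect par v x].
  elim/(par_ind rootG): v vr => [|v vr IHv _]; first by rewrite eqxx.
  have [pvr|/IHv[x [xr xE vx]]] := eqVneq (par v) r.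
    by exists v; rewrite connect0.
  by exists x; split=> //; rewrite fconnect_eqVf vx orbT.
have {vx} : #|desc v| <= #|desc x| by apply: subset_leq_card; rewrite desc_sub.
rewrite -leq_double => /leq_ltn_trans; apply.
rewrite ltnNge; apply/negP=> big; apply: (negP xr).
(* By [big], the maximum in [card_subtree_le] is [#|desc x|], which [weight_root_ge] bounds by the
   weight of [r]. *)
have wx : weight x <= weight r.
  apply: leq_trans (weight_root_ge acG xr xE); apply/bigmax_leqP=> -[W F] /andP[WF lx].
  apply: leq_trans (card_subtree_le xr WF lx) _; rewrite geq_max leqnn leq_subLR.
  by rewrite addnn.
have : r \in centroid G by rewrite cG set11.
rewrite inE => /forallP rmin; rewrite -in_set1 -cG inE; apply/forallP=> u.
exact: leq_trans wx (rmin u).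
Qed.

End Weight.

(** * Rebuilding the tree from its ancestor order *)

Lemma iso_of_fconnect (G G' : sgraph) (r : G) (r' : G') par par' (h : G -> G') :
    rooting r par -> rooting r' par' -> bijective h ->
    (forall v w, fconnect par' (h v) (h w) = fconnect par v w) ->
  isomorphic G G'.
Proof.
move=> rootG rootG' bij_h h_con; exists h => // x y.
have h_cov v w : covers par' (h v) (h w) = covers par v w.
  rewrite /covers h_con (bij_eq bij_h); congr [&& _, _ & _].
  apply/forallP/forallP=> H u; first by have := H (h u); rewrite !h_con (bij_eq bij_h).
  by case: bij_h => g gK hK; rewrite -(hK u) !h_con (can_eq gK).
by rewrite (adjE_covers rootG') !h_cov -(adjE_covers rootG).
Qed.

Theorem theorem5p7 (T T' : sgraph) (hT : is_tree T) (hT' : is_tree T')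
  (cT : single_centroid T) (cT' : single_centroid T')
  (f : edge T -> edge T') (bij_f : bijective f)
  (theta1 : forall e : edge T, theta [set f e] = theta [set e])
  (theta2 : forall e e' : edge T, e != e' ->
     theta [set f e; f e'] = theta [set e; e']) :
  isomorphic T T'.
Proof.
case/andP: hT => conT acT; case/andP: hT' => conT' acT'.
have /cards1P[r cr] : #|centroid T| == 1 by rewrite cT.
have /cards1P[r' cr'] : #|centroid T'| == 1 by rewrite cT'.
have [par rootT] := exists_rooting r acT conT.
have [par' rootT'] := exists_rooting r' acT' conT'.
have small := single_centroid_small_desc rootT acT cr.
have small' := single_centroid_small_desc rootT' acT' cr'.
set ch := child_end par r; set ch' := child_end par' r'.
have eq_card : #|T| = #|T'|.
  by rewrite (card_vertex rootT) (card_vertex rootT') (bij_eq_card bij_f).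
(* Both numbers are the largest part of the same partition. *)
have f_size e : #|T'| - #|desc par' (ch' (f e))| = #|T| - #|desc par (ch e)|.
  apply/eqP; rewrite eqn_leq; apply/andP; split.
    by apply: (theta1_max rootT small); rewrite -theta1; apply: theta1_mem.
  by apply: (theta1_max rootT' small'); rewrite theta1; apply: theta1_mem.
have f_con e e' : fconnect par' (ch' (f e)) (ch' (f e')) = fconnect par (ch e) (ch e').
  have [->|ee'] := eqVneq e e'; first by rewrite !connect0.
  rewrite -(theta2_mem rootT small) -(theta2_mem rootT' small').
  by rewrite -/ch -/ch' f_size theta2.
(* Lower endpoints follow [f]. The root is the lower endpoint of no edge, so it falls to the default
   [r']. *)
pose h v := if [pick e | ch e == v] is Some e then ch' (f e) else r'.
have h_ch e : h (ch e) = ch' (f e).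
  rewrite /h; case: pickP => [d /eqP/(child_end_inj rootT)->//|/(_ e)].
  by rewrite eqxx.
have h_r : h r = r'.
  rewrite /h; case: pickP => // e /eqP er.
  by have := child_end_neq_root rootT e; rewrite -/ch er eqxx.
have h_con v w : fconnect par' (h v) (h w) = fconnect par v w.
  have [->|wr] := eqVneq w r.
    by rewrite h_r (par_connect_root rootT') (par_connect_root rootT).
  have [e <-] := child_end_onto rootT wr; rewrite -/ch h_ch.
  have [->|vr] := eqVneq v r.
    rewrite h_r (fconnect_root rootT) (fconnect_root rootT').
    by rewrite (negPf (child_end_neq_root rootT' _)) (negPf (child_end_neq_root rootT _)).
  by have [d <-] := child_end_onto rootT vr; rewrite -/ch h_ch f_con.
apply: (iso_of_fconnect rootT rootT' _ h_con); apply: inj_card_bij; last by rewrite eq_card.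
(* Vertices with equal images lie below each other, so antisymmetry makes [h] injective. *)
by move=> v w hvw; apply: (fconnect_anti rootT); rewrite -h_con hvw connect0.
Qed.
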